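(* The Tukey depth $D_{CT}$ does not satisfy geometric monotonicity with respect to the Hausdorff distance $d_{\mathcal{H}}$. That is, the following assertion is false: for every $p\ge 1$, every compact convex random set $\Gamma$ with values in $\mathcal{K}_c(\mathbb{R}^p)$, and all $K,L,S\in\mathcal{K}_c(\mathbb{R}^p)$ such that $K$ maximizes $D_{CT}(\cdot;\Gamma)$ over $\mathcal{K}_c(\mathbb{R}^p)$ and $d_{\mathcal{H}}(K,S)=d_{\mathcal{H}}(K,L)+d_{\mathcal{H}}(L,S)$, one has $D_{CT}(L;\Gamma)\ge D_{CT}(S;\Gamma)$.
   Context: $\mathcal{K}_c(\mathbb{R}^p)$ denotes the set of non-empty compact convex subsets of $\mathbb{R}^p$, and $\mathbb{S}^{p-1}=\{x\in\mathbb{R}^p:\|x\|=1\}$ the Euclidean unit sphere. The support function of $K\in\mathcal{K}_c(\mathbb{R}^p)$ is $s_K:\mathbb{S}^{p-1}\to\mathbb{R}$, $s_K(u)=\sup_{k\in K}\langle k,u\rangle$. The Hausdorff distance is $d_{\mathcal{H}}(K,L)=\max\{\sup_{k\in K}\inf_{l\in L}\|k-l\|,\ \sup_{l\in L}\inf_{k\in K}\|k-l\|\}$. A map $\Gamma:\Omega\to\mathcal{K}_c(\mathbb{R}^p)$ on a probability space $(\Omega,\mathcal{A},\mathbb{P})$ is a compact convex random set if $\{\omega\in\Omega:\Gamma(\omega)\cap K\ne\emptyset\}\in\mathcal{A}$ for all $K\in\mathcal{K}_c(\mathbb{R}^p)$; equivalently, it is Borel measurable with respect to the Hausdorff metric.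 For $u\in\mathbb{S}^{p-1}$, $t\in\mathbb{R}$, define the halfspaces $S^-_{u,t}=\{K\in\mathcal{K}_c(\mathbb{R}^p):s_K(u)\le t\}$ and $S^+_{u,t}=\{K\in\mathcal{K}_c(\mathbb{R}^p):s_K(u)\ge t\}$. The Tukey depth of $K\in\mathcal{K}_c(\mathbb{R}^p)$ with respect to $\Gamma$ is $$D_{CT}(K;\Gamma)=\min\Big\{\inf_{u\in\mathbb{S}^{p-1},\,t\in\mathbb{R}:\ K\in S^-_{u,t}}\mathbb{P}(\Gamma\in S^-_{u,t}),\ \inf_{u\in\mathbb{S}^{p-1},\,t\in\mathbb{R}:\ K\in S^+_{u,t}}\mathbb{P}(\Gamma\in S^+_{u,t})\Big\}.$$ *)

(* Defs.v *)
From HB Require Import structures.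
From mathcomp Require Import all_boot all_order all_algebra.
From mathcomp Require Import all_classical all_reals all_analysis.

Set Implicit Arguments.
Unset Strict Implicit.
Unset Printing Implicit Defensive.

Import Order.TTheory GRing.Theory Num.Theory.
Import numFieldNormedType.Exports.

Local Open Scope classical_set_scope.
Local Open Scope ring_scope.

(* Vectors of R^p are row vectors.  The library norm on 'rV[R]_p is the sup
   norm, hence the separate Euclidean norm; both induce the same topology, so
   the library's [compact] is the intended one. *)
Definition inner (R : realType) (p : nat) (x y : 'rV[R]_p) : R :=
  \sum_(i < p) x ord0 i * y ord0 i.

Definition enorm (R : realType) (p : nat) (x : 'rV[R]_p) : R :=
  Num.sqrt (inner x x).

Definition sphere (R : realType) (p : nat) : set 'rV[R]_p :=
  [set u | enorm u = 1].

Definition Kc (R : realType) (p : nat) : set (set 'rV[R]_p) :=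
  [set K : set 'rV[R]_p |
     [/\ K !=set0, compact K & @convex_set R 'rV[R]_p K]].

Definition support_fun (R : realType) (p : nat) (K : set 'rV[R]_p)
    (u : 'rV[R]_p) : R :=
  sup [set inner k u | k in K].

Definition hausdorff_dist (R : realType) (p : nat) (K L : set 'rV[R]_p) : R :=
  Num.max (sup [set inf [set enorm (k - l) | l in L] | k in K])
          (sup [set inf [set enorm (k - l) | k in K] | l in L]).

Definition random_set (R : realType) (p : nat) (d : measure_display)
    (T : measurableType d) (Gamma : T -> set 'rV[R]_p) : Prop :=
  (forall w, Kc (Gamma w)) /\
  (forall K, Kc K -> measurable [set w | Gamma w `&` K !=set0]).

Definition halfspace_le (R : realType) (p : nat) (u : 'rV[R]_p) (t : R) :
    set (set 'rV[R]_p) :=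
  [set K | Kc K /\ support_fun K u <= t].

Definition halfspace_ge (R : realType) (p : nat) (u : 'rV[R]_p) (t : R) :
    set (set 'rV[R]_p) :=
  [set K | Kc K /\ t <= support_fun K u].

Definition tukey_depth (R : realType) (p : nat) (d : measure_display)
    (T : measurableType d) (P : probability T R) (Gamma : T -> set 'rV[R]_p)
    (K : set 'rV[R]_p) : \bar R :=
  Order.min
    (ereal_inf [set P (Gamma @^-1` halfspace_le ut.1 ut.2) | ut in
       [set ut : 'rV[R]_p * R |
          sphere ut.1 /\ halfspace_le ut.1 ut.2 K]])
    (ereal_inf [set P (Gamma @^-1` halfspace_ge ut.1 ut.2) | ut in
       [set ut : 'rV[R]_p * R |
          sphere ut.1 /\ halfspace_ge ut.1 ut.2 K]]).

(* Main.v *)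
Require Import Defs.
From HB Require Import structures.
From mathcomp Require Import all_boot all_order all_algebra.
From mathcomp Require Import all_classical all_reals all_analysis.
From mathcomp Require Import lra.

Import Order.TTheory GRing.Theory Num.Theory.
Import numFieldNormedType.Exports.

Local Open Scope classical_set_scope.
Local Open Scope ring_scope.

(** A counterexample lives already in dimension one.  A compact interval
    [[a, b]] of the line is a point [(a, b)] of the half-plane [a <= b]; its
    support function takes the values [b] and [- a] in the two unit
    directions, and the Hausdorff distance becomes the sup distance
    [max `|a - c| `|b - d|] ([hausdorff_dist_seg]).  The sup norm is not
    strictly convex, so metric segments are not unique: besides the straight
    path [[0, t]] from [[0, 0]] to [[0, 2]], the detour through [[-1, 1]] also
    has length 2.

    Let [Gamma] be [[0, 0]] or [[0, 2]] according to a fair coin.  A value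
    taken with probability [1/2] has depth at least [1/2]
    ([tukey_depth_ge_atom]).  Conversely no set is deeper than [1/2], since
    the right endpoint [b] of any interval satisfies [b < 2] or [0 < b], and
    one of the two values of [Gamma] is then missed by a halfspace bounded at
    [b] ([tukey_depth_coin_le]).  So [[0, 0]] is deepest and [[0, 2]] has
    depth [1/2].  But [[-1, 1]] has depth 0, because the left endpoint of
    [Gamma] is always 0, hence never at most [-1]. *)

(** * Attained extrema *)

Lemma sup_attained (R : realType) (E : set R) (x : R) :
  E x -> ubound E x -> sup E = x.
Proof.
move=> Ex ubx; apply/eqP; rewrite eq_le; apply/andP; split.
  by apply: ge_sup => //; exists x.
by apply: ub_le_sup => //; exists x.
Qed.

Lemma inf_attained (R : realType) (E : set R) (x : R) :
  E x -> lbound E x -> inf E = x.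
Proof.
move=> Ex lbx; apply/eqP; rewrite eq_le; apply/andP; split.
  by apply: ge_inf => //; exists x.
by apply: lb_le_inf => //; exists x.
Qed.

(** * Bounds on the Tukey depth *)

Section TukeyDepthBounds.
Context {R : realType} {p : nat} {d : measure_display} {T : measurableType d}.
Variables (P : probability T R) (Gamma : T -> set 'rV[R]_p).
Implicit Types (K : set 'rV[R]_p) (u : 'rV[R]_p) (t : R).

Lemma tukey_depth_le_halfspace_le K u t :
  sphere u -> halfspace_le u t K ->
  (tukey_depth P Gamma K <= P (Gamma @^-1` halfspace_le u t))%E.
Proof.
move=> u1 Kut; rewrite /tukey_depth ge_min; apply/orP; left.
by apply: ereal_inf_lbound; exists (u, t).
Qed.

Lemma tukey_depth_le_halfspace_ge K u t :
  sphere u -> halfspace_ge u t K ->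
  (tukey_depth P Gamma K <= P (Gamma @^-1` halfspace_ge u t))%E.
Proof.
move=> u1 Kut; rewrite /tukey_depth ge_min; apply/orP; right.
by apply: ereal_inf_lbound; exists (u, t).
Qed.

(** Every halfspace containing [K] contains the value of [Gamma] throughout
    the event [Gamma = K]. *)
Lemma tukey_depth_ge_atom K (A : set T) :
  (forall u t, measurable (Gamma @^-1` halfspace_le u t)) ->
  (forall u t, measurable (Gamma @^-1` halfspace_ge u t)) ->
  measurable A -> (forall w, A w -> Gamma w = K) ->
  (P A <= tukey_depth P Gamma K)%E.
Proof.
move=> mle mge mA AK; rewrite /tukey_depth le_min.
apply/andP; split; apply: le_ereal_inf_tmp => _ [[u t] [_ Kut] <-];
  by apply: le_measure; rewrite ?inE// => w /AK /= ->.
Qed.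

End TukeyDepthBounds.

(** * Intervals of the line *)

Section Intervals.
Context {R : realType}.
Implicit Types (a b c e x : R).

(** The quantification over the single coordinate makes [seg a b] a product
    of intervals, so that its compactness is an instance of Tychonoff. *)
Definition seg a b : set 'rV[R]_1 :=
  [set v | forall i, `[a, b]%classic (v ord0 i)].

Lemma segE a b (v : 'rV[R]_1) : seg a b v <-> a <= v ord0 ord0 <= b.
Proof.
split; first by move/(_ ord0); rewrite /= in_itv.
by move=> abv i; rewrite (ord1 i) /= in_itv.
Qed.

Lemma seg_const a b x : a <= x <= b -> seg a b (const_mx x).
Proof. by move=> abx; apply/segE; rewrite mxE. Qed.

Lemma Kc_seg a b : a <= b -> Kc (seg a b).
Proof.
move=> ab; split.
- by exists (const_mx a); apply: seg_const; rewrite lexx.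
- apply: (@rV_compact _ 1 (fun=> `[a, b]%classic)) => i.
  exact: segment_compact.
- move=> u v l; rewrite !inE => /segE /andP[au ub] /segE /andP[av vb].
  apply/segE; rewrite !mxE.
  have l0 : 0 <= l%:num by [].
  have l1 : l%:num <= 1 by [].
  move: l0 l1; rewrite /unstable.onem; set s := l%:num => s0 s1.
  by apply/andP; split; nra.
Qed.

Lemma inner1 (u v : 'rV[R]_1) : inner u v = u ord0 ord0 * v ord0 ord0.
Proof. by rewrite /inner big_ord1. Qed.

Lemma enorm1 (u : 'rV[R]_1) : enorm u = `|u ord0 ord0|.
Proof. by rewrite /enorm inner1 -expr2 sqrtr_sqr. Qed.

Lemma sphere_const x : `|x| = 1 -> sphere (const_mx x : 'rV[R]_1).
Proof. by move=> x1; rewrite /sphere /= enorm1 mxE. Qed.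

Lemma support_fun_segR a b :
  a <= b -> support_fun (seg a b) (const_mx 1) = b.
Proof.
move=> ab; apply: sup_attained.
  exists (const_mx b); first by apply: seg_const; rewrite ab lexx.
  by rewrite inner1 !mxE mulr1.
by move=> _ [v /segE /andP[_ vb] <-]; rewrite inner1 mxE mulr1.
Qed.

Lemma support_fun_segL a b :
  a <= b -> support_fun (seg a b) (const_mx (-1)) = - a.
Proof.
move=> ab; apply: sup_attained.
  exists (const_mx a); first by apply: seg_const; rewrite ab lexx.
  by rewrite inner1 !mxE mulrN1.
by move=> _ [v /segE /andP[av _] <-]; rewrite inner1 mxE mulrN1 lerN2.
Qed.

(** The nearest point of [[c, e]] to [v] is the clamp of [v] to [[c, e]]. *)
Lemma dist_seg c e (v : 'rV[R]_1) : c <= e ->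
  inf [set enorm (v - l) | l in seg c e] =
  Num.max (Num.max (c - v ord0 ord0) (v ord0 ord0 - e)) 0.
Proof.
move=> ce; set x := v ord0 ord0; apply: inf_attained.
  exists (const_mx (Num.max c (Num.min x e))).
    apply: seg_const.
    by case: (leP x e) => ?; [case: (leP c x)|case: (leP c e)] => ?;
      apply/andP; split; lra.
  rewrite enorm1 !mxE -/x.
  case: (leP x e) => xe; case: (leP c) => cx.
  - by rewrite subrr normr0 max_r// ge_max; apply/andP; split; lra.
  - rewrite ler0_norm; last lra.
    by rewrite opprB [Num.max (_ - _) _]max_l ?max_l; lra.
  - rewrite ger0_norm; last lra.
    by rewrite [Num.max (_ - _) _]max_r ?max_l; lra.
  - by exfalso; lra.
move=> _ [l /segE /andP[cl le] <-]; rewrite enorm1 !mxE -/x.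
rewrite !ge_max normr_ge0 andbT; apply/andP; split.
  by rewrite distrC; apply: le_trans (ler_norm _); lra.
by apply: le_trans (ler_norm _); lra.
Qed.

(** The distance to an interval is a convex function, so its supremum over
    [[a, b]] is attained at [a] or at [b]. *)
Lemma excess_seg a b c e : a <= b -> c <= e ->
  sup [set inf [set enorm (k - l) | l in seg c e] | k in seg a b] =
  Num.max (Num.max (c - a) (b - e)) 0.
Proof.
move=> ab ce; apply: sup_attained; last first.
  move=> _ [k /segE /andP[ak kb] <-]; rewrite dist_seg//.
  by rewrite !ge_max !le_max lexx !orbT andbT; apply/andP; split;
    apply/orP; left; apply/orP; [left|right]; lra.
have [ha|hb] := leP (b - e) (c - a).
  exists (const_mx a); first by apply: seg_const; rewrite lexx ab.
  rewrite dist_seg// mxE; congr Num.max.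
  by rewrite max_l //; lra.
exists (const_mx b); first by apply: seg_const; rewrite lexx ab.
rewrite dist_seg// mxE; congr Num.max.
by rewrite max_r //; lra.
Qed.

Lemma hausdorff_dist_seg a b c e : a <= b -> c <= e ->
  hausdorff_dist (seg a b) (seg c e) = Num.max `|a - c| `|b - e|.
Proof.
move=> ab ce; rewrite /hausdorff_dist excess_seg//.
have -> : [set inf [set enorm (k - l) | k in seg a b] | l in seg c e] =
    [set inf [set enorm (l - k) | k in seg a b] | l in seg c e].
  apply: eq_imagel => l _; congr inf; apply: eq_imagel => k _.
  by rewrite !enorm1 !mxE distrC.
rewrite excess_seg//.
apply/eqP; rewrite eq_le !ge_max !le_max !normr_ge0 !orbT !andbT.
apply/andP; split.
  have subr_le_norm (x y : R) : y - x <= `|x - y| by rewrite distrC ler_norm.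
  by rewrite !subr_le_norm !ler_norm !orbT.
by apply/andP; split; [case: (ger0P (a - c))|case: (ger0P (b - e))] => _;
  rewrite ?opprB lexx ?orbT.
Qed.

End Intervals.

(** * The counterexample *)

Section FairCoin.
Variable R : realType.

Definition coin : probability bool R := bernoulli_prob (2^-1 : R).

Definition coin_seg (w : bool) : set 'rV[R]_1 := if w then seg 0 2 else seg 0 0.

Lemma coin1 (w : bool) : coin [set w] = (2^-1)%:E.
Proof.
rewrite /coin /= bernoulli_probE; last by apply/andP; split; lra.
have onemV2 : unstable.onem 2^-1 = 2^-1 :> R by rewrite /unstable.onem; lra.
rewrite onemV2 !diracE; case: w; rewrite !in_set1 /= ?mem_set//=.
- by rewrite mule1 mule0 adde0.
- by rewrite mule1 mule0 add0e.
Qed.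

(** An event missing [w] lies in the atom of the other face. *)
Lemma coin_le (w : bool) (A : set bool) : ~ A w -> (coin A <= (2^-1)%:E)%E.
Proof.
move=> nAw; rewrite -(coin1 (~~ w)); apply: le_measure; rewrite ?inE//.
by move=> v Av; case: v w Av nAw => -[].
Qed.

Lemma Kc_coin_seg w : Kc (coin_seg w).
Proof. by case: w; apply: Kc_seg; lra. Qed.

Lemma random_set_coin_seg : random_set coin_seg.
Proof. by split => //; exact: Kc_coin_seg. Qed.

Lemma tukey_depth_coin_seg_ge w :
  ((2^-1)%:E <= tukey_depth coin coin_seg (coin_seg w))%E.
Proof. by rewrite -(coin1 w); apply: tukey_depth_ge_atom => // _ ->. Qed.

(** In direction 1, the tightest halfspace of the form [<=] around [K] misses
    [[0, 2]] when the right endpoint of [K] is below 2; otherwise the tightest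
    one of the form [>=] misses [[0, 0]]. *)
Lemma tukey_depth_coin_le K : Kc K ->
  (tukey_depth coin coin_seg K <= (2^-1)%:E)%E.
Proof.
move=> KK; have u1 : sphere (const_mx 1 : 'rV[R]_1).
  by apply: sphere_const; rewrite normr1.
have [b2|b2] := ltP (support_fun K (const_mx 1)) 2.
  apply: le_trans
    (tukey_depth_le_halfspace_le _ _ _ _ _ u1 (conj KK (lexx _))) _.
  apply: (@coin_le true) => -[_].
  by rewrite /coin_seg support_fun_segR; lra.
apply: le_trans
  (tukey_depth_le_halfspace_ge _ _ _ _ _ u1 (conj KK (lexx _))) _.
apply: (@coin_le false) => -[_].
by rewrite /coin_seg support_fun_segR; lra.
Qed.

(** In direction [-1] the support function is 1 on [[-1, 1]] and 0 on both
    values of [coin_seg]. *)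
Lemma tukey_depth_detour : (tukey_depth coin coin_seg (seg (-1) 1) <= 0)%E.
Proof.
have u1 : sphere (const_mx (-1) : 'rV[R]_1).
  by apply: sphere_const; rewrite normrN1.
have LL : @Kc R 1 (seg (-1) 1) by apply: Kc_seg; lra.
apply: le_trans
  (tukey_depth_le_halfspace_ge _ _ _ _ _ u1 (conj LL (lexx _))) _.
rewrite [X in coin X](_ : _ = set0) ?measure0//.
rewrite -subset0 => w [_]; rewrite support_fun_segL; last lra.
by case: w; rewrite /coin_seg support_fun_segL; lra.
Qed.

End FairCoin.

Theorem proposition4p6 (R : realType) :
  ~ (forall (p : nat) (d : measure_display) (T : measurableType d)
        (P : probability T R) (Gamma : T -> set 'rV[R]_p)
        (K L S : set 'rV[R]_p),
      (1 <= p)%N ->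
      random_set Gamma ->
      Kc K -> Kc L -> Kc S ->
      (forall K' : set 'rV[R]_p, Kc K' ->
         (tukey_depth P Gamma K' <= tukey_depth P Gamma K)%E) ->
      hausdorff_dist K S = hausdorff_dist K L + hausdorff_dist L S ->
      (tukey_depth P Gamma S <= tukey_depth P Gamma L)%E).
Proof.
move=> monotone.
have deepest K' : Kc K' -> (tukey_depth (coin R) (@coin_seg R) K' <=
    tukey_depth (coin R) (@coin_seg R) (seg 0 0))%E.
  move=> /tukey_depth_coin_le /le_trans; apply.
  exact: (@tukey_depth_coin_seg_ge R false).
have geodesic : hausdorff_dist (seg 0 0 : set 'rV[R]_1) (seg 0 2) =
    hausdorff_dist (seg 0 0) (seg (-1) 1) +
    hausdorff_dist (seg (-1) 1) (seg 0 2).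
  rewrite !hausdorff_dist_seg; try lra.
  rewrite !sub0r !opprK !subr0 !normrN normr0 !normr1.
  rewrite (_ : 1 - 2 = -1 :> R); last lra.
  by rewrite normrN1 !maxxx max_r ger0_norm; lra.
have depth_SL : (tukey_depth (coin R) (@coin_seg R) (seg 0 2) <=
    tukey_depth (coin R) (@coin_seg R) (seg (-1) 1))%E.
  apply: (monotone 1%N _ bool (coin R) (@coin_seg R) (seg 0 0)) => //.
  - exact: random_set_coin_seg.
  - exact: (@Kc_coin_seg R false).
  - by apply: Kc_seg; lra.
  - exact: (@Kc_coin_seg R true).
have := le_trans (@tukey_depth_coin_seg_ge R true)
  (le_trans depth_SL (@tukey_depth_detour R)).
by rewrite lee_fin; lra.
Qed.
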